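(* Let $n\ge1$, $\delta=(\delta_1,\dots,\delta_n)\in\mathbb{N}^n$ with $\delta_j\ge1$ for all $j$, and let $p$ be a real polynomial in $n$ variables of multi-degree at most $\delta$ with vector of Bernstein coefficients $b_\delta=(b_{I,\delta})_{I\le\delta}$. Let $A_0\in\mathbb{R}^{m\times n}$ and $b_0\in\mathbb{R}^m$, and let $p^*$ be the optimal value of the problem $$\text{minimize } p(x)\quad\text{subject to } x\in[0,1]^n,\ A_0x\le b_0.$$ Let $(\tilde A_\delta,\tilde c_\delta)$ consist of any subset of the rows of the pair $(A_\delta,c_\delta)$ defined in the context, and let $p_\delta^*$ be the optimal value of the linear program $$\begin{array}{ll}\text{minimize}& b_\delta\cdot z_\delta\\ \text{subject to}& 0_\delta\le z_\delta\le u_\delta,\\ & 1_\delta\cdot z_\delta=1,\\ & \tilde A_\delta z_\delta\le\tilde c_\delta,\\ & \sum_{I\le\delta}\left(A_0\frac{I}{\delta}\right)z_{I,\delta}\le b_0,\end{array}$$ in the variables $z_\delta=(z_{I,\delta})_{I\le\delta}$. Then $p_\delta^*\le p^*$.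
   Context: Multi-index notation: for $I,J\in\mathbb{N}^n$, $I\le J$ means $i_l\le j_l$ for all $l$; $x^I=x_1^{i_1}\cdots x_n^{i_n}$; $\binom{I}{J}=\prod_{l}\binom{i_l}{j_l}$; $\frac{I}{J}=(i_1/j_1,\dots,i_n/j_n)$ (with $0/0=0$), regarded as a column vector in $\mathbb{R}^n$. Inequalities between vectors are componentwise. The optimal value of an infeasible minimization problem is $+\infty$. Bernstein polynomials: for $I\le K$ in $\mathbb{N}^n$, $B_{I,K}(x)=\prod_{l=1}^n\binom{K_l}{i_l}x_l^{i_l}(1-x_l)^{K_l-i_l}$. The Bernstein coefficients of $p=\sum_{I\le\delta}p_Ix^I$ are $b_{I,\delta}=\sum_{J\le I}\frac{\binom{I}{J}}{\binom{\delta}{J}}p_J$, so that $p=\sum_{I\le\delta}b_{I,\delta}B_{I,\delta}$. Vectors indexed by $\{I:I\le\delta\}$: $u_\delta$ has entries $u_{I,\delta}=B_{I,\delta}\left(\frac{I}{\delta}\right)$; $0_\delta$ and $1_\delta$ have all entries $0$, respectively $1$. The pair $(A_\delta,c_\delta)$: for $K\le\delta$, $I\le K$, write $B_{I,K}=\sum_{J\le\delta}\hat b^{(I,K)}_JB_{J,\delta}$ (unique expansion in the Bernstein basis of degree $\delta$). Then $A_\delta z_\delta\le c_\delta$ denotes the system of linear inequalities in $z_\delta$ made of $$0\le\sum_{J\le\delta}\hat b^{(I,K)}_Jz_{J,\delta}\le B_{I,K}\left(\tfrac{I}{K}\right)\qquad\text{for all }K\le\delta,\ K\ne\delta,\ I\le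 K.$$ *)

(* Defs.v *)
From HB Require Import structures.
From mathcomp Require Import all_boot all_order all_algebra.
From mathcomp Require Import mpoly.
From mathcomp Require Import boolp classical_sets reals constructive_ereal ereal.

Set Implicit Arguments.
Unset Strict Implicit.
Unset Printing Implicit Defensive.

Import Order.TTheory GRing.Theory Num.Theory.

Local Open Scope classical_set_scope.
Local Open Scope ring_scope.

(* The multi-indices [I <= K]; a vector indexed by them is an element of
   [{ffun mindex K -> R}]. *)
Definition mindex n (K : 'X_{1..n}) : Type :=
  {dffun forall l : 'I_n, 'I_(K l).+1}.

HB.instance Definition _ n (K : 'X_{1..n}) := Finite.on (mindex K).

Definition mindex_mnm n (K : 'X_{1..n}) (I : mindex K) : 'X_{1..n} :=
  [multinom (I l : nat) | l < n].
Coercion mindex_mnm : mindex >-> multinom.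

Section Bernstein.
Variables (R : realType) (n : nat).
Implicit Types (I J K delta : 'X_{1..n}) (p : {mpoly R[n]}).

Definition mbinom I J : nat := (\prod_(l < n) 'C(I l, J l))%N.

(* [0 / 0 = 0] since [x / 0 = 0] in a MathComp field. *)
Definition mratio I K : 'cV[R]_n := \col_l ((I l)%:R / (K l)%:R).

Definition evalp p (x : 'cV[R]_n) : R := p.@[fun l => x l 0].

Definition multidegree_le p delta : Prop :=
  {in msupp p, forall J, (J <= delta)%MM}.

Definition bernstein K (I : mindex K) : {mpoly R[n]} :=
  \prod_(l < n)
    ('C(K l, I l)%:R *: ('X_l ^+ I l * (1 - 'X_l) ^+ (K l - I l))).

Definition bernstein_coefs p delta : {ffun mindex delta -> R} :=
  [ffun I : mindex delta => \sum_(J : mindex I)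
     (mbinom I J)%:R / (mbinom delta J)%:R * p@_J].

Definition bernstein_peaks delta : {ffun mindex delta -> R} :=
  [ffun I : mindex delta => evalp (bernstein I) (mratio I delta)].

(* The expansion of a polynomial in the Bernstein basis of degree [delta]; it
   exists and is unique when the multidegree is at most [delta], and only such
   polynomials are expanded below. *)
Definition bernstein_expansion p delta : {ffun mindex delta -> R} :=
  xget 0 [set b : {ffun mindex delta -> R} |
          p = \sum_(J : mindex delta) b J *: bernstein J].

(* The double inequality attached to a pair [(K, I)], [I <= K], yields two rows
   of [A z <= c]: [(K, I, false)] is the lower bound [0 <= ...], rewritten as
   [- ... <= 0], and [(K, I, true)] is the upper bound. *)
Definition row_index delta : finType :=
  ({KI : {K : mindex delta & mindex K} | tag KI != delta :> 'X_{1..n}}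
   * bool)%type.

Definition row_deg delta (r : row_index delta) : mindex delta := tag (val r.1).
Definition row_pos delta (r : row_index delta) : mindex (row_deg r) :=
  tagged (val r.1).

Definition Adelta delta (r : row_index delta) : {ffun mindex delta -> R} :=
  let b := bernstein_expansion (bernstein (row_pos r)) delta in
  if r.2 then b else - b.

Definition cdelta delta (r : row_index delta) : R :=
  if r.2 then evalp (bernstein (row_pos r)) (mratio (row_pos r) (row_deg r)) else 0.

Definition dotp (T : finType) (u v : {ffun T -> R}) : R :=
  \sum_(t : T) u t * v t.

(* The value of an infeasible problem is [ereal_inf set0 = +oo]. *)
Definition optimal_value (T : Type) (feasible : set T) (f : T -> R) : \bar R :=
  ereal_inf [set (f x)%:E | x in feasible].

Definition pop_feasible m (A0 : 'M[R]_(m, n)) (b0 : 'cV[R]_m) : set 'cV[R]_n :=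
  [set x : 'cV[R]_n | (forall l, 0 <= x l 0 <= 1) /\
                      (forall i, (A0 *m x) i 0 <= b0 i 0)].

Definition lp_feasible delta (S : {set row_index delta})
    m (A0 : 'M[R]_(m, n)) (b0 : 'cV[R]_m) : set {ffun mindex delta -> R} :=
  [set z : {ffun mindex delta -> R} |
    [/\ forall I : mindex delta, 0 <= z I <= bernstein_peaks delta I,
        dotp [ffun=> 1] z = 1,
        forall r, r \in S -> dotp (Adelta r) z <= cdelta r
      & forall i, (\sum_(I : mindex delta)
                      z I *: (A0 *m mratio I delta)) i 0 <= b0 i 0]].

End Bernstein.

(* Main.v *)
Require Import Defs.
From mathcomp Require Import all_boot all_order all_algebra.
From mathcomp Require Import mpoly.
From mathcomp Require Import boolp classical_sets reals constructive_ereal ereal.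
From mathcomp Require Import zify ring.

(** The linear program is a relaxation: every point [x] of the box satisfying
    [A0 x <= b0] lifts to the vector [z] of values at [x] of the Bernstein
    polynomials of degree [delta], and this [z] is feasible with objective
    value [p(x)]. The infimum defining the linear program therefore runs over
    a larger set of values.

    Two facts make the lifted point feasible. The first is that the Bernstein
    polynomials of degree [delta] span every polynomial that occurs. All the
    expansions come from one elevation formula ([homog_elevation],
    [bernstein_elevation]), obtained by multiplying a product of powers of [x]
    and [1 - x] by a suitable power of [x + (1 - x) = 1]. Applied to a monomial
    (no factors [1 - x]) it gives the Bernstein form of [p], hence the
    objective value; its cases [1] and [x_l] say that the coordinates of [z]
    sum to [1] and that the average of the nodes [I / delta] weighted by [z] is
    [x], whence the constraints [1 . z = 1] and [A0 x <= b0]. Applied to a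
    Bernstein polynomial of lower degree it shows that a row of the matrix
    evaluated at [z] is, up to sign, the value of that polynomial at [x].

    The second fact is that on the box a Bernstein polynomial [B_(I,K)] is
    nonnegative and attains its maximum at [I / K] ([bernstein_le_peak]). This
    gives both the bounds on [z] and the rows; one variable at a time it is the
    inequality of arithmetic and geometric means. *)

Set Implicit Arguments.
Unset Strict Implicit.
Unset Printing Implicit Defensive.

Import Order.TTheory GRing.Theory Num.Theory.

Local Open Scope ring_scope.

(** * Degree elevation in one variable *)

(** Both sides count the pairs of nested subsets of sizes [i] and [j] of a set
    of size [d]. *)
Lemma mul_bin_subset d i j : (i <= d)%N -> (j <= d)%N ->
  ('C(d, j) * 'C(j, i) = 'C(d, i) * ((i <= j) * 'C(d - i, j - i)))%N.
Proof.
move=> le_id le_jd; have [le_ij|lt_ji] := leqP i j; last first.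
  by rewrite [X in (_ * X)%N](bin_small lt_ji) mul0n !muln0.
have fact_gt : (0 < i`! * (j - i)`! * (d - j)`!)%N by rewrite !muln_gt0 !fact_gt0.
apply/eqP; rewrite mul1n -(eqn_pmul2r fact_gt).
have := bin_fact le_jd; have := bin_fact le_ij; have := bin_fact le_id.
have /bin_fact : (j - i <= d - i)%N by rewrite leq_sub2r.
have -> : (d - i - (j - i) = d - j)%N by rewrite subnBA // subnK.
move=> E1 E2 E3 E4; apply/eqP; transitivity d`!.
  by rewrite -E4 -E3; ring.
by rewrite -E2 -E1; ring.
Qed.

(** The left side is multiplied by [(x + y) ^ (d - i - m) = 1] and expanded. The
    boolean factor [i <= j] discards the indices for which the truncated
    subtraction [j - i] would wrongly yield [0]. *)
Lemma homog_elevation (A : comNzRingType) (x y : A) d i m :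
    x + y = 1 -> (i + m <= d)%N ->
  x ^+ i * y ^+ m =
    \sum_(j < d.+1) (x ^+ j * y ^+ (d - j)) *+ ((i <= j) * 'C(d - i - m, j - i)).
Proof.
move=> xy1 le_imd.
rewrite -[LHS]mulr1 -[X in _ * X](expr1n A (d - i - m)) -[X in X ^+ (d - i - m)]xy1.
rewrite [x + y]addrC exprDn big_distrr /=.
rewrite -(big_mkord predT (fun j =>
  (x ^+ j * y ^+ (d - j)) *+ ((i <= j) * 'C(d - i - m, j - i)))).
(* The binomial expansion is the range [i <= j <= d - m] of the sum. *)
have le_i : (i <= d.+1)%N by rewrite (leq_trans (leq_addr m i)) // leqW.
rewrite (big_cat_nat (n := i)) //=.
rewrite [X in _ = X + _]big_nat [X in _ = X + _]big1 ?add0r; last first.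
  by move=> j /andP[_ ji]; rewrite leqNgt ji mul0n mulr0n.
rewrite -[X in \sum_(X <= _ < _) _]add0n big_addn.
rewrite (big_cat_nat (n := (d - i - m).+1)) //=; last first.
  by rewrite subSn ?(leq_trans (leq_addr m i)) // ltnS leq_subr.
rewrite [X in _ = _ + X]big_nat [X in _ = _ + X]big1 ?addr0; last first.
  by move=> j /andP[lj _]; rewrite addnK bin_small ?muln0.
rewrite big_mkord; apply: eq_bigr => j _.
rewrite leq_addl mul1n addnK mulrnAr; congr (_ *+ _).
have lej : (j <= d - i - m)%N by rewrite -ltnS.
have -> : (d - (j + i) = m + (d - i - m - j))%N by lia.
by rewrite !exprD; ring.
Qed.

(** * The maximum of a Bernstein polynomial *)

(** With [a = i / (i + m)] and [b = m / (i + m)], the arithmetic mean of [i]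
    copies of [t * b] and [m] copies of [(1 - t) * a] is [a * b], whatever [t]
    is, so their product is at most [(a * b) ^ (i + m)]; the common factor
    [b ^ i * a ^ m] cancels, being nonzero unless [i] or [m] vanishes. *)
Lemma power_prod_le_mode (R : realFieldType) (t : R) i m : 0 <= t <= 1 ->
  t ^+ i * (1 - t) ^+ m <=
    (i%:R / (i + m)%:R) ^+ i * (m%:R / (i + m)%:R) ^+ m.
Proof.
move=> /andP[t0 t1]; have u0 : 0 <= 1 - t by rewrite subr_ge0.
case: (posnP i) => [->|i0].
  rewrite add0n expr0 !mul1r; case: (posnP m) => [->|m0]; first by rewrite !expr0.
  rewrite divff ?pnatr_eq0 -?lt0n // expr1n exprn_ile1 //.
  by rewrite lerBlDr lerDl.
case: (posnP m) => [->|m0].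
  by rewrite addn0 expr0 !mulr1 divff ?pnatr_eq0 -?lt0n // expr1n exprn_ile1.
have k0 : (0 < (i + m)%:R :> R) by rewrite ltr0n addn_gt0 i0.
have N0 : (i + m)%:R != 0 :> R by rewrite gt_eqF.
set a := _ / _; set b := _ / (i + m)%:R.
have a0 : 0 < a by rewrite divr_gt0 // ltr0n.
have b0 : 0 < b by rewrite divr_gt0 // ltr0n.
have Ei : i%:R = a * (i + m)%:R by rewrite divfK.
have Em : m%:R = b * (i + m)%:R by rewrite divfK.
pose E (s : 'I_i + 'I_m) := if s is inl _ then t * b else (1 - t) * a.
have E0 : {in predT, forall s, 0 <= E s}.
  by case=> s _ /=; rewrite mulr_ge0 // ltW.
have [+ _] := leif_AGM E0.
rewrite !big_sumType /= !prodr_const !sumr_const !card_ord card_sum !card_ord.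
have -> : (t * b *+ i + (1 - t) * a *+ m) / (i + m)%:R = a * b.
  rewrite -(mulr_natr (t * b)) -(mulr_natr (_ * a)) Ei Em.
  apply: (mulIf N0); rewrite divfK //.
  by move: (_%:R) => N; ring.
have -> : (a * b) ^+ (i + m) = (a ^+ i * b ^+ m) * (b ^+ i * a ^+ m).
  by rewrite exprMn !exprD; ring.
have -> : (t * b) ^+ i * ((1 - t) * a) ^+ m =
    (t ^+ i * (1 - t) ^+ m) * (b ^+ i * a ^+ m).
  by rewrite !exprMn; ring.
by rewrite ler_pM2r ?mulr_gt0 ?exprn_gt0.
Qed.

(** * Multi-indices *)

(** Distributivity of products over sums whose ranges depend on the factor.
    Since [bigA_distr_big_dep] and [big_fprod] meet at families of tagged
    elements, the multi-indices are passed through that encoding. *)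
Lemma prod_sum_mindex (A : comNzRingType) n (K : 'X_{1..n})
    (G : 'I_n -> nat -> A) :
  \prod_(l < n) \sum_(j < (K l).+1) G l j =
    \sum_(J : mindex K) \prod_(l < n) G l (J l).
Proof.
pose T l : finType := 'I_(K l).+1.
pose F l : {ffun T l -> A} := [ffun j : T l => G l j].
transitivity (\prod_(l < n) \sum_(j : T l) F l j).
  by apply: eq_bigr => l _; apply: eq_bigr => j _; rewrite ffunE.
under eq_bigr => l _ do rewrite (big_tag (fun k (j : T k) => F k j) l).
rewrite bigA_distr_big_dep /= -big_fprod.
rewrite (reindex (@fprod_of_dffun _ T)) /=; last exact/onW_bij/fprod_of_dffun_bij.
apply: eq_bigr => J _; apply: eq_bigr => l _.
by rewrite ffunE fprodE mnmE.
Qed.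

Lemma mindex_le n (K : 'X_{1..n}) (I : mindex K) : (I <= K)%MM.
Proof. by apply/mnm_lepP => l; rewrite mnmE -ltnS. Qed.

Lemma bin_mindex_neq0 (R : numDomainType) n (K : 'X_{1..n}) (I : mindex K) l :
  'C(K l, I l)%:R != 0 :> R.
Proof.
by rewrite pnatr_eq0 -lt0n bin_gt0; have /mnm_lepP := mindex_le I.
Qed.

Lemma mbinom_gt0 n (I J : 'X_{1..n}) : (0 < mbinom I J)%N -> (J <= I)%MM.
Proof.
by move=> /gt0_prodn gt0; apply/mnm_lepP => l; rewrite -bin_gt0; apply: gt0.
Qed.

Lemma mindex_mnm_inj n (K : 'X_{1..n}) : injective (@mindex_mnm n K).
Proof.
move=> I J /mnmP eqIJ; apply/ffunP => l; apply: val_inj.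
by have := eqIJ l; rewrite !mnmE.
Qed.

Lemma mindexP n (K J : 'X_{1..n}) : (J <= K)%MM ->
  exists I : mindex K, J = I.
Proof.
move=> /mnm_lepP leJ.
exists ([ffun l => Ordinal (leJ l : (J l < (K l).+1)%N)] : mindex K).
by apply/mnmP => l; rewrite mnmE ffunE.
Qed.

(** A function supported on [s] and on the multi-indices [<= K] has the same sum
    over either; this lets sums over a support and sums over a box of
    multi-indices be exchanged. *)
Lemma sum_mindex (V : nmodType) n (K : 'X_{1..n}) (s : seq 'X_{1..n})
    (F : 'X_{1..n} -> V) : uniq s ->
    (forall J, J \notin s -> F J = 0) ->
    (forall J, ~~ (J <= K)%MM -> F J = 0) ->
  \sum_(J : mindex K) F J = \sum_(J <- s) F J.
Proof.
move=> s_uniq F_s F_K.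
transitivity (\sum_(J : mindex K) \sum_(J' <- s | J' == J) F J').
  apply: eq_bigr => J _; have [Js|Js] := boolP (mindex_mnm J \in s).
    by rewrite -big_filter filter_pred1_uniq // big_seq1.
  rewrite F_s // big_seq_cond big1 // => J' /andP[J's /eqP eqJ].
  by rewrite eqJ (negPf Js) in J's.
rewrite (exchange_big_dep predT) //=; apply: eq_bigr => J _.
have [leJ|] := boolP (J <= K)%MM; last by move=> /F_K ->; rewrite big1.
have [I ->] := mindexP leJ; rewrite (big_pred1 I) // => I' /=.
by rewrite eq_sym (inj_eq (@mindex_mnm_inj _ _)).
Qed.

(** * Expansions in the Bernstein basis *)

(** The family of exponents is arbitrary, so that monomials ([m = 0]) and
    Bernstein polynomials of lower degree ([i + m = K]) are both instances. *)
Lemma bernstein_elevation (R : realType) n (delta : 'X_{1..n})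
    (i m : 'I_n -> nat) : (forall l, (i l + m l <= delta l)%N) ->
  \prod_(l < n) ('X_l ^+ i l * (1 - 'X_l) ^+ m l) =
    \sum_(J : mindex delta)
      (\prod_(l < n)
         (((i l <= J l) * 'C(delta l - i l - m l, J l - i l))%:R
            / 'C(delta l, J l)%:R)) *: bernstein R J :> {mpoly R[n]}.
Proof.
move=> le_im.
under eq_bigr => l _ do
  rewrite (homog_elevation (d := delta l)) ?(addrC 'X_l) ?subrK //.
rewrite (prod_sum_mindex _ (fun l j => ('X_l ^+ j * (1 - 'X_l) ^+ (delta l - j))
    *+ ((i l <= j) * 'C(delta l - i l - m l, j - i l)))).
apply: eq_bigr => J _; rewrite -scaler_prod; apply: eq_bigr => l _.
by rewrite scalerA divfK ?bin_mindex_neq0 // scaler_nat.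
Qed.

Lemma mpolyX_bernstein (R : realType) n (delta J : 'X_{1..n}) :
    (J <= delta)%MM ->
  'X_[J] = \sum_(I : mindex delta)
     ((mbinom I J)%:R / (mbinom delta J)%:R) *: bernstein R I.
Proof.
move=> /mnm_lepP leJ; rewrite mpolyXE_id.
have le_J0 l : (J l + 0 <= delta l)%N by rewrite addn0.
transitivity (\prod_(l < n) ('X_l ^+ J l * (1 - 'X_l) ^+ 0) : {mpoly R[n]}).
  by apply: eq_bigr => l _; rewrite expr0 mulr1.
rewrite (bernstein_elevation _ le_J0); apply: eq_bigr => I _; congr (_ *: _).
rewrite !natr_prod -prodf_div; apply: eq_bigr => l _; rewrite subn0.
have /mnm_lepP leI := mindex_le I.
apply/eqP; rewrite eqr_div ?bin_mindex_neq0 ?pnatr_eq0 -?lt0n ?bin_gt0 //.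
by rewrite -!natrM mulnC -mul_bin_subset // mulnC.
Qed.

(** The range of summation no longer depends on [I]: the terms with [J] not
    below [I] vanish together with [mbinom I J]. *)
Lemma bernstein_coefsE (R : realType) n (p : {mpoly R[n]})
    (delta : 'X_{1..n}) (I : mindex delta) :
  bernstein_coefs p delta I =
    \sum_(J <- msupp p) (mbinom I J)%:R / (mbinom delta J)%:R * p@_J.
Proof.
rewrite ffunE; pose F J : R := (mbinom I J)%:R / (mbinom delta J)%:R * p@_J.
apply: (@sum_mindex _ _ I (msupp p) F) => [|J|J nJI]; first exact: msupp_uniq.
  by move=> /memN_msupp_eq0; rewrite /F => ->; rewrite mulr0.
rewrite /F; case: (posnP (mbinom I J)) => [->|/mbinom_gt0 JI].
  by rewrite !mul0r.
by rewrite JI in nJI.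
Qed.

Lemma bernstein_form (R : realType) n (p : {mpoly R[n]}) (delta : 'X_{1..n}) :
    multidegree_le p delta ->
  p = \sum_(I : mindex delta) bernstein_coefs p delta I *: bernstein R I.
Proof.
move=> hp; rewrite [LHS]mpolyE.
under [RHS]eq_bigr => I _ do rewrite bernstein_coefsE scaler_suml.
rewrite exchange_big /= !big_seq; apply: eq_bigr => J /hp leJ.
rewrite (mpolyX_bernstein _ leJ) scaler_sumr.
by apply: eq_bigr => I _; rewrite scalerA mulrC.
Qed.

(** * The lifted point *)

Lemma dotpN (R : realType) (T : finType) (u v : {ffun T -> R}) :
  dotp (- u) v = - dotp u v.
Proof. by rewrite /dotp -sumrN; apply: eq_bigr => i _; rewrite ffunE mulNr. Qed.

Definition bernstein_values (R : realType) n (K : 'X_{1..n}) (x : 'cV[R]_n)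
    : {ffun mindex K -> R} :=
  [ffun I : mindex K => evalp (bernstein R I) x].

Lemma dotp_bernstein_values (R : realType) n (K : 'X_{1..n})
    (b : {ffun mindex K -> R}) (x : 'cV[R]_n) :
  dotp b (bernstein_values K x) =
    evalp (\sum_(I : mindex K) b I *: bernstein R I) x.
Proof.
rewrite /evalp raddf_sum; apply: eq_bigr => I _.
by rewrite ffunE /= mevalZ.
Qed.

(** Any expansion chosen by [bernstein_expansion] is a valid one, so only the
    existence of an expansion has to be shown, which is degree elevation from
    [K] to [delta]. *)
Lemma bernstein_expansionE (R : realType) n (delta : 'X_{1..n})
    (K : mindex delta) (I : mindex K) (p := bernstein R I) :
  p = \sum_(J : mindex delta) bernstein_expansion p delta J *: bernstein R J.
Proof.
rewrite /bernstein_expansion; case: xgetP => [b _ //|none].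
have /mnm_lepP leI := mindex_le I; have /mnm_lepP leK := mindex_le K.
have le_IK l : (I l + (K l - I l) <= delta l)%N by rewrite subnKC.
exfalso; apply: (none [ffun J : mindex delta =>
  (\prod_(l < n) 'C(K l, I l)%:R) * \prod_(l < n)
     (((I l <= J l) * 'C(delta l - I l - (K l - I l), J l - I l))%:R
        / 'C(delta l, J l)%:R)]).
rewrite /= /p {1}/bernstein scaler_prod (bernstein_elevation R le_IK) scaler_sumr.
by apply: eq_bigr => J _; rewrite ffunE scalerA.
Qed.

Lemma evalp_bernstein (R : realType) n (K : 'X_{1..n}) (I : mindex K)
    (x : 'cV[R]_n) :
  evalp (bernstein R I) x = \prod_(l < n)
    ('C(K l, I l)%:R * (x l 0 ^+ I l * (1 - x l 0) ^+ (K l - I l))).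
Proof.
rewrite /evalp rmorph_prod; apply: eq_bigr => l _.
by rewrite /= mevalZ mevalM !rmorphXn /= mevalB meval1 mevalXU.
Qed.

(** The inequality holds factor by factor. A variable of degree [0] contributes
    the constant factor [1], for any value of the ratio [0 / 0]. *)
Lemma bernstein_le_peak (R : realType) n (K : 'X_{1..n}) (I : mindex K)
    (x : 'cV[R]_n) : (forall l, 0 <= x l 0 <= 1) ->
  0 <= evalp (bernstein R I) x <= evalp (bernstein R I) (mratio R I K).
Proof.
move=> x01.
have factor_ge0 l : 0 <= x l 0 ^+ I l * (1 - x l 0) ^+ (K l - I l).
  by have /andP[x0 x1] := x01 l; rewrite mulr_ge0 ?exprn_ge0 ?subr_ge0.
rewrite !evalp_bernstein prodr_ge0 => [|l _]; last by rewrite mulr_ge0.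
apply: ler_prod => l _; rewrite mulr_ge0 //= ler_wpM2l // mxE.
have /mnm_lepP/(_ l) leI := mindex_le I.
have := power_prod_le_mode (I l) (K l - I l) (x01 l); rewrite subnKC //.
(* [1 - I / K = (K - I) / K] fails only for [K = 0], where the exponents vanish. *)
case: (posnP (K l)) => [K0|K0]; first by rewrite K0 !expr0.
by rewrite natrB // mulrBl divff // pnatr_eq0 -lt0n.
Qed.

Lemma bernstein_values_monomial (R : realType) n (delta J : 'X_{1..n})
    (x : 'cV[R]_n) : (J <= delta)%MM ->
  \sum_(I : mindex delta) (mbinom I J)%:R / (mbinom delta J)%:R *
      bernstein_values delta x I = \prod_(l < n) x l 0 ^+ J l.
Proof.
move=> leJ; rewrite -mevalX (mpolyX_bernstein _ leJ) raddf_sum.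
by apply: eq_bigr => I _; rewrite ffunE /= mevalZ.
Qed.

(** The case [J = 0] of [bernstein_values_monomial]. *)
Lemma sum_bernstein_values (R : realType) n (delta : 'X_{1..n})
    (x : 'cV[R]_n) : \sum_(I : mindex delta) bernstein_values delta x I = 1.
Proof.
have le0 : (0%MM <= delta)%MM by apply/mnm_lepP => l; rewrite mnm0E.
have mbinom0 (I : 'X_{1..n}) : mbinom I 0%MM = 1%N.
  by apply: big1 => l _; rewrite mnm0E bin0.
transitivity (\prod_(l < n) x l 0 ^+ (0%MM : 'X_{1..n}) l).
  rewrite -(bernstein_values_monomial x le0); apply: eq_bigr => I _.
  by rewrite !mbinom0 divr1 mul1r.
by apply: big1 => l _; rewrite mnm0E.
Qed.

(** The [k]-th coordinate is the case [J = U_(k)] of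
    [bernstein_values_monomial], whose coefficients are the ratios
    [I k / delta k]; the monomial ['X_k] has multidegree at most [delta] only
    because [delta k >= 1]. *)
Lemma mean_bernstein_values (R : realType) n (delta : 'X_{1..n})
    (x : 'cV[R]_n) : (forall l, (1 <= delta l)%N) ->
  \sum_(I : mindex delta) bernstein_values delta x I *: mratio R I delta = x.
Proof.
move=> delta_gt0; apply/colP => k; rewrite summxE.
have le1 : (U_(k) <= delta)%MM.
  by apply/mnm_lepP => l; rewrite mnm1E; case: eqP => // <-.
have mbinom1 (I : 'X_{1..n}) : mbinom I U_(k)%MM = I k.
  rewrite /mbinom (bigD1 k) //= mnm1E eqxx bin1 big1 ?muln1 // => l.
  by rewrite mnm1E eq_sym => /negPf->; rewrite bin0.
transitivity (\prod_(l < n) x l 0 ^+ U_(k)%MM l).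
  rewrite -(bernstein_values_monomial x le1); apply: eq_bigr => I _.
  by rewrite !mxE !mbinom1 mulrC.
rewrite (bigD1 k) //= mnm1E eqxx expr1 big1 ?mulr1 // => l.
by rewrite mnm1E eq_sym => /negPf->.
Qed.

(** Each constraint of the linear program is met for its own reason: the box by
    the location of the peaks, the normalization by partition of unity, the
    rows by the peaks of the polynomials of lower degree, and the last system
    by the reproduction of [x] as a barycenter of the nodes. *)
Lemma lp_feasible_bernstein_values (R : realType) n (delta : 'X_{1..n})
    (delta_gt0 : forall l, (1 <= delta l)%N) m (A0 : 'M[R]_(m, n))
    (b0 : 'cV[R]_m) (S : {set row_index delta}) (x : 'cV[R]_n) :
  pop_feasible A0 b0 x -> lp_feasible S A0 b0 (bernstein_values delta x).
Proof.
move=> [x01 Ax]; split=> [I||r _|i].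
- by rewrite !ffunE; apply: bernstein_le_peak.
- rewrite -[RHS](sum_bernstein_values delta x).
  by apply: eq_bigr => I _; rewrite ffunE mul1r.
- have /andP[ge0 le_peak] := bernstein_le_peak (row_pos r) x01.
  have dotE := dotp_bernstein_values
    (bernstein_expansion (bernstein R (row_pos r)) delta) x.
  rewrite -bernstein_expansionE in dotE.
  rewrite /Adelta /cdelta; case: r.2; first by rewrite dotE.
  by rewrite dotpN dotE oppr_le0.
- have -> : \sum_(I : mindex delta) bernstein_values delta x I *:
      (A0 *m mratio R I delta) = A0 *m x.
    rewrite -[in RHS](mean_bernstein_values x delta_gt0) mulmx_sumr.
    by apply: eq_bigr => I _; rewrite scalemxAr.
  exact: Ax.
Qed.

Theorem proposition5 (R : realType) (n : nat) (hn : (1 <= n)%N)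
    (delta : 'X_{1..n}) (hdelta : forall l : 'I_n, (1 <= delta l)%N)
    (p : {mpoly R[n]}) (hp : multidegree_le p delta)
    (m : nat) (A0 : 'M[R]_(m, n)) (b0 : 'cV[R]_m)
    (S : {set row_index delta}) :
  (optimal_value (lp_feasible S A0 b0) (dotp (bernstein_coefs p delta))
   <= optimal_value (pop_feasible A0 b0) (evalp p))%E.
Proof.
apply: ereal_inf_le_tmp => _ [x x_feas <-].
exists (bernstein_values delta x); first exact: lp_feasible_bernstein_values.
by rewrite dotp_bernstein_values -bernstein_form.
Qed.
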